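(* Let $A$ be a finite set, $n\ge 3$, and let $\sigma\subseteq A^n$ be a core (of some essential key relation) whose pattern is full and which is preserved by a WNU vector-function. Suppose $A_1\times\dots\times A_n$ (with $A_i\subseteq A$) is a key block of $\sigma$. Then there exist a finite field $F$ and bijections $\phi_i:A_i\to F$ ($i=1,\dots,n$) such that $$\sigma\cap(A_1\times\dots\times A_n)=\{(x_1,\dots,x_n):\ \phi_1(x_1)+\dots+\phi_n(x_n)=0\}.$$
   Context: A unary vector-function is a tuple $\Psi=(\psi_1,\dots,\psi_n)$ of maps $\psi_i:A\to A$ acting coordinatewise; it preserves $\rho$ if $\Psi(\rho)\subseteq\rho$; $\Psi\circ\Psi'$ denotes coordinatewise composition. $\rho\subseteq A^n$ is a key relation if there is $\beta\in A^n\setminus\rho$ (a key tuple) such that every $\alpha\in A^n\setminus\rho$ is mapped to $\beta$ by some unary vector-function preserving $\rho$; $\rho$ is essential if it cannot be written as a conjunction of relations of smaller arities. Core: given a key relation $\rho$, a relation $\sigma\subseteq\rho$ is a core of $\rho$ if there is a unary vector-function $\Psi$ such that (1) $\Psi$ preserves $\rho$; (2) $\Psi(\alpha)=\alpha$ for some key tuple $\alpha$ of $\rho$; (3) $\Psi(\rho)=\sigma$; (4) $\Psi\circ\Psi=\Psi$; (5) there is no unary vector-function $\Psi'$ satisfying (1)–(4) with $\Psi'(A^n)\subsetneq\Psi(A^n)$. $\mathrm{Key}(\sigma)$ denotes $\sigma$ together with all its key tuples. Consider the graph on $\mathrm{Key}(\sigma)$ where two tuples are adjacent if they differ in exactly one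 coordinate; a key block of $\sigma$ is a connected component of this graph containing a key tuple of $\sigma$. The pattern of $\sigma$: for $i\ne j$, $i\overset{\sigma}{\sim}j$ iff there do NOT exist $a_1,\dots,a_n,b_i,b_j$ with $(a_1,\dots,a_n)\notin\sigma$ while the tuples obtained by replacing $a_i$ by $b_i$, $a_j$ by $b_j$, and both, all lie in $\sigma$; full means $i\overset{\sigma}{\sim}j$ for all $i,j$. A WNU is an $m$-ary ($m\ge2$) operation $f$ with $f(x,\dots,x)=x$ and $f(y,x,\dots,x)=\dots=f(x,\dots,x,y)$; a WNU vector-function is a tuple $(f_1,\dots,f_n)$ of $m$-ary WNUs, preserving $\sigma$ if applying $f_i$ to the $i$-th coordinates of any $m$ tuples of $\sigma$ yields a tuple in $\sigma$. *)

(* Defs.v *)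
From HB Require Import structures.
From mathcomp Require Import all_boot all_order all_algebra all_fingroup all_field.
Set Implicit Arguments. Unset Strict Implicit. Unset Printing Implicit Defensive.

Notation tup A n := {ffun 'I_n -> A}.
Notation rel_on A n := {set {ffun 'I_n -> A}}.

Section Defs.
Variables (A : finType) (n : nat).

Definition uvf := {ffun 'I_n -> {ffun A -> A}}.

Definition vapply (Psi : uvf) (x : tup A n) : tup A n := [ffun i => Psi i (x i)].

Definition vcomp (Psi Psi' : uvf) : uvf := [ffun i => [ffun a => Psi i (Psi' i a)]].

Definition preserves (Psi : uvf) (rho : rel_on A n) : bool :=
  [forall x in rho, vapply Psi x \in rho].

Definition vimage (Psi : uvf) (rho : rel_on A n) : rel_on A n :=
  [set vapply Psi x | x in rho].

Definition key_tuple (rho : rel_on A n) (beta : tup A n) : bool :=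
  (beta \notin rho) &&
  [forall alpha in ~: rho, exists Psi : uvf, preserves Psi rho && (vapply Psi alpha == beta)].

Definition key_relation (rho : rel_on A n) : Prop := exists beta, key_tuple rho beta.

Definition conj_smaller (rho : rel_on A n) : Prop :=
  exists (k : nat) (ms : 'I_k -> nat) (idx : forall j : 'I_k, 'I_(ms j) -> 'I_n)
         (R : forall j : 'I_k, {set {ffun 'I_(ms j) -> A}}),
    (forall j, ms j < n) /\
    (forall x : tup A n, x \in rho <-> (forall j, [ffun t => x (idx j t)] \in R j)).

Definition essential (rho : rel_on A n) : Prop := ~ conj_smaller rho.

Definition core_map (rho : rel_on A n) (Psi : uvf) : Prop :=
  [/\ preserves Psi rho,
      exists2 alpha, key_tuple rho alpha & vapply Psi alpha = alpha
    & vcomp Psi Psi = Psi].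

Definition is_core_of (rho sigma : rel_on A n) : Prop :=
  sigma \subset rho /\
  exists Psi : uvf,
    [/\ core_map rho Psi, vimage Psi rho = sigma &
        ~ exists Psi' : uvf, core_map rho Psi' /\
            vimage Psi' setT \proper vimage Psi setT].

Definition Key (sigma : rel_on A n) : rel_on A n :=
  sigma :|: [set x | key_tuple sigma x].

Definition adjacent (x y : tup A n) : bool := #|[set i | x i != y i]| == 1.

Definition key_edge (sigma : rel_on A n) : rel (tup A n) :=
  fun x y => [&& x \in Key sigma, y \in Key sigma & adjacent x y].

Definition key_block (sigma : rel_on A n) (B : rel_on A n) : Prop :=
  exists2 b, key_tuple sigma b & B = [set y | connect (key_edge sigma) b y].

Definition upd (a : tup A n) (i : 'I_n) (b : A) : tup A n :=
  [ffun k => if k == i then b else a k].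

Definition pattern_rel (sigma : rel_on A n) (i j : 'I_n) : Prop :=
  ~ exists (a : tup A n) (bi bj : A),
      [/\ a \notin sigma, upd a i bi \in sigma, upd a j bj \in sigma
        & upd (upd a i bi) j bj \in sigma].

Definition pattern_full (sigma : rel_on A n) : Prop :=
  forall i j : 'I_n, i != j -> pattern_rel sigma i j.

Definition is_WNU (m : nat) (f : {ffun 'I_m -> A} -> A) : Prop :=
  2 <= m /\
  (forall x, f [ffun _ => x] = x) /\
  (forall x y (k l : 'I_m),
      f [ffun t => if t == k then y else x] = f [ffun t => if t == l then y else x]).

Definition WNU_preserves (m : nat) (f : 'I_n -> {ffun 'I_m -> A} -> A)
    (sigma : rel_on A n) : Prop :=
  (forall i, is_WNU (f i)) /\
  forall rows : 'I_m -> tup A n, (forall k, rows k \in sigma) ->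
    [ffun i => f i [ffun k => rows k i]] \in sigma.

End Defs.

(* Main.v *)
(* Write x o y for f(x, ..., x, y). Rectangularity of sigma in every pair of
   coordinates (the full pattern) and n >= 3 imply that f cannot send a key tuple
   a into sigma by x |-> f(c, ..., c, x) when c in sigma differs from a in one
   coordinate only. By minimality of the core this unary vector-function is then
   injective on sigma, so b o - permutes the i-th projection of sigma for every
   b in A_i, and iterating turns f(x, b, ..., b, y) into an operation p preserving
   sigma with p(x, b, b) = x = p(b, b, x). With p and minimality again,
   a tuple of the block has exactly one completion in sigma in each coordinate.
   Fixing o in sigma inside the block, x + y := p(x, o, y) is then an abelian group
   law on each A_i, and sigma is the graph of a linear equation. All tuples of the
   block outside sigma are key tuples, so the endomorphisms of this group are
   transitive on its nonzero elements: it is elementary abelian, that is, the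
   additive group of a finite field. *)
Require Import Defs.
From HB Require Import structures.
From mathcomp Require Import all_boot all_order all_algebra all_fingroup all_field.
From mathcomp Require Import all_solvable.
Import GRing.Theory.
Local Open Scope ring_scope.
Set Implicit Arguments.
Unset Strict Implicit.

(** * Iterates of self-maps of a finite set *)

Lemma iter_idempotent {X : finType} (h : X -> X) (x : X) :
  exists2 N, (0 < N)%N & iter (N + N) h x = iter N h x.
Proof.
have [p p_gt0 [i hi]] : exists2 p, (0 < p)%N & exists i, iter (i + p) h x = iter i h x.
  have /injectivePn[i [j neq_ij eq_ij]] :
      ~~ injectiveb (fun k : 'I_(#|X|.+1) => iter k h x).
    apply/negP => /injectiveP/leq_card.
    by rewrite card_ord ltnn.
  wlog lt_ij : i j neq_ij eq_ij / (i < j)%N.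
    move=> IH; case: (ltngtP i j) => [|lt_ji|/val_inj eij]; first exact: IH.
      by apply: (IH j i) => //; rewrite eq_sym.
    by rewrite eij eqxx in neq_ij.
  exists (j - i)%N; first by rewrite subn_gt0.
  by exists i; rewrite subnKC // ltnW.
have period k q : (i <= k)%N -> iter (k + q * p) h x = iter k h x.
  move=> le_ik; elim: q => [|q IHq]; first by rewrite addn0.
  rewrite mulSn addnCA addnC -{}[RHS]IHq.
  rewrite -(subnK (leq_trans le_ik (leq_addr (q * p) k))) -addnA.
  by rewrite iterD hi -iterD.
(* A positive multiple of the period [p] that is at least the preperiod [i]. *)
exists (i.+1 * p)%N; first by rewrite muln_gt0 p_gt0.
by apply: period; apply: leq_trans (leq_pmulr _ p_gt0).
Qed.

(** Extended by the identity off [D], [g] is a permutation, so its order divides that of the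
    symmetric group. The exponent depends neither on [D] nor on [g], so that one exponent will serve
    all coordinates at once. *)
Lemma iter_card_perm {A : finType} (D : {set A}) (g : A -> A) :
    {in D, forall x, g x \in D} -> {in D &, injective g} ->
  {in D, forall x, iter #|{perm A}| g x = x}.
Proof.
move=> gD ginj x Dx.
pose h y := if y \in D then g y else y.
have hinj : injective h.
  move=> y z; rewrite /h; case: ifPn => Dy; case: ifPn => Dz // eyz.
  - exact: ginj.
  - by rewrite -eyz gD in Dz.
  - by rewrite eyz gD in Dy.
have iterD k : iter k g x \in D by elim: k => //= k; apply: gD.
have iterE k : iter k (perm hinj) x = iter k g x.
  by elim: k => //= k ->; rewrite permE /h iterD.
rewrite -iterE -permX.
by rewrite -cardsT expg_cardG ?inE // perm1.
Qed.

(** * Unary vector-functions, essential relations and key tuples *)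

Section UnaryVectorFunctions.
Context {A : finType} {n : nat}.
Implicit Types (x y z : tup A n) (Phi Psi : uvf A n) (rho sigma : rel_on A n).

Definition proj sigma (i : 'I_n) : {set A} :=
  [set (z : tup A n) i | z in sigma].

Definition vid : uvf A n := [ffun=> [ffun a => a]].

Lemma mem_proj {sigma z} i : z \in sigma -> z i \in proj sigma i.
Proof. by move=> zs; apply/imsetP; exists z. Qed.

Lemma updE x i b k : upd x i b k = if k == i then b else x k.
Proof. by rewrite ffunE. Qed.

Lemma upd_id x i : upd x i (x i) = x.
Proof. by apply/ffunP=> k; rewrite updE; case: eqP => // ->. Qed.

Lemma upd_upd x i b c : upd (upd x i b) i c = upd x i c.
Proof. by apply/ffunP=> k; rewrite !updE; case: eqP. Qed.

Lemma updC x i j b c : i != j -> upd (upd x i b) j c = upd (upd x j c) i b.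
Proof.
move=> ij; apply/ffunP=> k; rewrite !updE.
by case: (k =P i) => // ->; rewrite (negPf ij).
Qed.

Lemma vapply_upd Phi x i b :
  vapply Phi (upd x i b) = upd (vapply Phi x) i (Phi i b).
Proof. by apply/ffunP=> k; rewrite !ffunE; case: eqP => // ->. Qed.

Lemma vapply_comp Phi Psi x : vapply (vcomp Phi Psi) x = vapply Phi (vapply Psi x).
Proof. by apply/ffunP=> k; rewrite !ffunE. Qed.

Lemma vapply_id x : vapply vid x = x.
Proof. by apply/ffunP=> k; rewrite !ffunE. Qed.

Lemma preservesP {Phi rho} :
  reflect (forall x, x \in rho -> vapply Phi x \in rho) (preserves Phi rho).
Proof. exact: forall_inP. Qed.

Lemma key_tupleP {rho b} :
  reflect (b \notin rho /\ forall x, x \notin rho ->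
             exists2 Phi, preserves Phi rho & vapply Phi x = b)
          (key_tuple rho b).
Proof.
apply: (iffP andP) => -[bN H]; split=> //.
  move=> x xN; have /forall_inP/(_ x) := H; rewrite inE => /(_ xN)/existsP[Phi].
  by case/andP=> ? /eqP ?; exists Phi.
apply/forall_inP=> x; rewrite inE => /H[Phi ? ?].
by apply/existsP; exists Phi; apply/andP; split=> //; apply/eqP.
Qed.

(** Otherwise [rho] would be the conjunction of its [n] projections that forget one coordinate
    each. *)
Lemma essential_tuple rho : essential rho ->
  exists2 a, a \notin rho & forall i, exists b, upd a i b \in rho.
Proof.
move=> ess.
have [/exists_inP[a] | none] :=
    boolP [exists a in ~: rho, [forall i, [exists b, upd a i b \in rho]]].
  rewrite inE => aN /forallP H; exists a => // i.
  by have /existsP[b ?] := H i; exists b.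
case: ess; exists n, (fun=> n.-1), (fun j t => lift j t),
  (fun j => [set [ffun t => (x : tup A n) (lift j t)] | x in rho]).
split=> [j|x]; first by rewrite ltn_predL (leq_trans _ (ltn_ord j)).
split=> [xr j|H]; first by apply/imsetP; exists x.
apply: contraR none => xN; apply/exists_inP; exists x; first by rewrite inE.
apply/forallP=> i; have /imsetP[y yr /ffunP e] := H i.
apply/existsP; exists (y i); rewrite (_ : upd x i (y i) = y) //.
apply/ffunP=> k; rewrite updE; case: (unliftP i k) => [t ->|->]; last by rewrite eqxx.
by have := e t; rewrite !ffunE eq_sym (negPf (neq_lift i t)).
Qed.

(** A vector-function sending the tuple of [essential_tuple] to [b] carries the completions
    along. *)
Lemma essential_key_tuple rho b i :
  essential rho -> key_tuple rho b -> exists c, upd b i c \in rho.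
Proof.
move=> /essential_tuple[a aN H] /key_tupleP[bN /(_ a aN)[Phi /preservesP pPhi <-]].
have [c cr] := H i; exists (Phi i c); rewrite -vapply_upd; exact: pPhi.
Qed.

Lemma key_tuple_image sigma a Phi :
    key_tuple sigma a -> preserves Phi sigma -> vapply Phi a \notin sigma ->
  key_tuple sigma (vapply Phi a).
Proof.
move=> /key_tupleP[aN H] pPhi PaN; apply/key_tupleP; split=> // x /H[Psi pPsi <-].
exists (vcomp Phi Psi); last by rewrite vapply_comp.
by apply/preservesP=> z zs; rewrite vapply_comp (preservesP pPhi) // (preservesP pPsi).
Qed.

Lemma vapply_iter Phi N x :
  vapply (iter N (vcomp Phi) vid) x = iter N (vapply Phi) x.
Proof. by elim: N => [|N IH] /=; rewrite ?vapply_id // vapply_comp IH. Qed.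

Lemma uvf_eq Phi Psi : (forall x, vapply Phi x = vapply Psi x) -> Phi = Psi.
Proof.
move=> H; apply/ffunP=> i; apply/ffunP=> a.
by have /ffunP/(_ i) := H [ffun=> a]; rewrite !ffunE.
Qed.

End UnaryVectorFunctions.

(** * Rigidity of cores *)

Section Core.
Context {A : finType} {n : nat} {rho sigma : rel_on A n}.
Hypotheses (n_gt1 : (1 < n)%N) (ess : essential rho) (core : is_core_of rho sigma).

Lemma other_index (i : 'I_n) : exists j, j != i.
Proof.
have /card_gt0P[j] : (0 < #|predC1 i|)%N by rewrite cardC1 card_ord -ltnS prednK // ltnW.
by exists j.
Qed.

Lemma core_retraction : exists Psi : uvf A n,
  [/\ preserves Psi rho /\ vcomp Psi Psi = Psi,
      forall x, x \in rho -> vapply Psi x \in sigma,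
      forall x, x \in sigma -> x \in rho /\ vapply Psi x = x,
      forall a, key_tuple sigma a -> key_tuple rho a /\ vapply Psi a = a
    & forall Xi, core_map rho Xi -> ~~ (vimage Xi setT \proper vimage Psi setT)].
Proof.
have [/subsetP sub [Psi [[pPsi [a0 ka0 fix0] idem] imPsi minPsi]]] := core.
have imrho x : x \in rho -> vapply Psi x \in sigma.
  by move=> xr; rewrite -imPsi; apply: imset_f.
have fixs x : x \in sigma -> vapply Psi x = x.
  by rewrite -imPsi => /imsetP[y _ ->]; rewrite -vapply_comp idem.
exists Psi; split=> // [x xs|a ka|Xi cXi].
- by split; [apply: sub | apply: fixs].
- have [a0N _] := key_tupleP ka0.
  have a0Ns : a0 \notin sigma by apply: contra a0N; apply: sub.
  have [aN /(_ _ a0Ns)[Om /preservesP pOm Oma0]] := key_tupleP ka.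
  (* To see that [Psi] fixes [a] at [i], complete [a0] at some [j] other than [i]: [Om] sends the
     completion to a tuple of [sigma], fixed by [Psi], that agrees with [a] at [i]. *)
  have fixa : vapply Psi a = a.
    apply/ffunP=> i; have [j ji] := other_index i.
    have [c /imrho/pOm] := essential_key_tuple j ess ka0.
    rewrite !vapply_upd fix0 Oma0 => /fixs/ffunP/(_ i).
    by rewrite !(ffunE, updE) eq_sym (negPf ji).
  split=> //; apply/key_tupleP; split.
    by apply: contra aN => /imrho; rewrite fixa.
  have [_ H0] := key_tupleP ka0.
  move=> x /H0[Phi /preservesP pPhi Phix].
  exists (vcomp Om (vcomp Psi Phi)); last by rewrite !vapply_comp Phix fix0.
  by apply/preservesP=> z /pPhi/imrho/pOm/sub; rewrite !vapply_comp.
- by apply/negP=> prXi; apply: minPsi; exists Xi.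
Qed.

(* By minimality of the core map, an idempotent power of [Psi o Phi' o Phi o Psi],
   where [Psi] is the core map and [Phi'] sends [Phi a] back to [a], has the same
   image as [Psi]. *)
Lemma core_injective a Phi : key_tuple sigma a -> preserves Phi sigma ->
    vapply Phi a \notin sigma ->
  forall i, {in proj sigma i &, injective (Phi i)}.
Proof.
move=> ka /preservesP pPhi PaN i.
have [Psi [[pPsi idem] imrho fixs keyr minPsi]] := core_retraction.
have [aN /(_ _ PaN)[Phi' /preservesP pPhi' Phi'a]] := key_tupleP ka.
have [kra fixa] := keyr _ ka.
pose Th := vcomp Psi (vcomp Phi' (vcomp Phi Psi)).
have ThE x : vapply Th x = vapply Psi (vapply Phi' (vapply Phi (vapply Psi x))).
  by rewrite !vapply_comp.
have [[//|N] _ idemN] := iter_idempotent (vcomp Th) vid.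
set Xi := iter N.+1 _ _ in idemN.
have XiE x : vapply Xi x = iter N.+1 (vapply Th) x by rewrite vapply_iter.
have cXi : core_map rho Xi.
  split.
  - apply/preservesP=> x xr; rewrite XiE; elim: N.+1 => //= k IH.
    by rewrite ThE; have [] := fixs _ (imrho _ (fixs _ (pPhi' _ (pPhi _ (imrho _ IH)))).1).
  - exists a => //; rewrite XiE; elim: N.+1 => //= k ->.
    by rewrite ThE fixa Phi'a fixa.
  - by apply: uvf_eq => x; rewrite vapply_comp !XiE -iterD -!vapply_iter idemN.
have subXi : vimage Xi setT \subset vimage Psi setT.
  apply/subsetP=> _ /imsetP[x _ ->]; rewrite XiE iterS ThE; exact: imset_f.
have /negP := minPsi _ cXi; rewrite properE subXi /= => /negP/negPn/subsetP supXi.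
(* The tuple [upd a i b] lies in the image of [Psi], hence in that of the idempotent [Xi], which
   therefore fixes it. *)
have Xi_id b : Psi i b = b -> Xi i b = b.
  move=> fixb; have /supXi/imsetP[y _ eb] : upd a i b \in vimage Psi setT.
    by apply/imsetP; exists (upd a i b); rewrite // vapply_upd fixa fixb.
  have : vapply Xi (upd a i b) = upd a i b.
    rewrite eb -vapply_comp; congr vapply; by case: cXi.
  by move/ffunP/(_ i); rewrite vapply_upd !updE eqxx.
have Xi_Phi b c : Psi i b = b -> Psi i c = c -> Phi i b = Phi i c -> Xi i b = Xi i c.
  move=> fb fc ePhi; have: vapply Xi (upd a i b) = vapply Xi (upd a i c).
    rewrite !XiE !iterSr !ThE; congr iter.
    by rewrite !(vapply_upd Psi a) fb fc !(vapply_upd Phi) ePhi.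
  by move/ffunP/(_ i); rewrite !vapply_upd !updE eqxx.
have fixp b : b \in proj sigma i -> Psi i b = b.
  by case/imsetP=> z /fixs[_ /ffunP/(_ i)]; rewrite ffunE => zi ->.
move=> b c /fixp fb /fixp fc /(Xi_Phi _ _ fb fc).
by rewrite !Xi_id.
Qed.

Lemma core_key_upd a i : key_tuple sigma a -> exists b, upd a i b \in sigma.
Proof.
have [Psi [_ imrho _ keyr _]] := core_retraction.
case/keyr=> kra fixa; have [b /imrho] := essential_key_tuple i ess kra.
by rewrite vapply_upd fixa; exists (Psi i b).
Qed.

End Core.

(** * The collapse argument for a ternary relation *)

Section NoCollapse.
Context {A : finType} {m : nat}.
Variables (f1 f2 f3 : {ffun 'I_m -> A} -> A) (T : A -> A -> A -> bool).
Hypotheses (idem1 : forall x, f1 [ffun=> x] = x)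
  (idem2 : forall x, f2 [ffun=> x] = x) (idem3 : forall x, f3 [ffun=> x] = x).
Hypothesis presT : forall x y z : {ffun 'I_m -> A},
  (forall t, T (x t) (y t) (z t)) -> T (f1 x) (f2 y) (f3 z).
Hypothesis rect12 : forall x x' y y' z,
  T x y z -> T x' y z -> T x y' z -> T x' y' z.
Hypothesis rect13 : forall x x' y z z',
  T x y z -> T x' y z -> T x y z' -> T x' y z'.
Hypothesis rect23 : forall x y y' z z',
  T x y z -> T x y' z -> T x y z' -> T x y' z'.
Variables a0 a1 b0 b1 c0 c1 : A.
Hypotheses (T100 : T a1 b0 c0) (T010 : T a0 b1 c0) (T001 : T a0 b0 c1).

(* The sets [J] such that [f3], applied to [c1] on [J] and [c0] off [J],
   gives a value [z] with [T a0 b0 z] are stable under removal of a point [t]: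
   evaluate [(f1, f2, f3)] on the partition of the indices into [t], the
   complement of [J], and [J] minus [t]. *)
Lemma collapse_contradiction :
  (forall t, T a0 b0 (f3 [ffun s => if s == t then c0 else c1])) -> T a0 b0 c0.
Proof.
move=> col.
have sel0 (r : seq 'I_m) : T a0 b0 (f3 [ffun s => if s \in r then c0 else c1]).
  elim: r => [|t r IH].
    by rewrite (_ : [ffun=> _] = [ffun=> c1]) ?idem3 //; apply/ffunP=> s; rewrite !ffunE.
  have [tr|tNr] := boolP (t \in r).
    rewrite (_ : [ffun=> _] = [ffun s => if s \in r then c0 else c1]) //.
    by apply/ffunP=> s; rewrite !ffunE inE; case: (s =P t) => // ->; rewrite tr.
  pose a := f1 [ffun s => if s == t then a1 else a0].
  pose b := f2 [ffun s => if s \in r then b1 else b0].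
  have Ta01 : T a b0 c1.
    apply: rect13 (col t) _ T001; rewrite -[b0]idem2.
    by apply: presT => s; rewrite !ffunE; case: ifP.
  have T0b1 : T a0 b c1.
    apply: rect23 IH _ T001; rewrite -[a0]idem1.
    by apply: presT => s; rewrite !ffunE; case: ifP.
  have Tab1 : T a b c1 by apply: rect12 T001 Ta01 T0b1.
  set z := f3 _.
  (* The triple fed in is [(a1, b0, c0)] at [t], [(a0, b1, c0)] on [r] and [(a0, b0, c1)] elsewhere.
     Rectangularity then replaces [b] by [b0] and [a] by [a0]. *)
  have Tabz : T a b z.
    apply: presT => s; rewrite !ffunE inE; case: (s =P t) => [->|_] /=.
      by rewrite (negPf tNr).
    by case: ifP.
  by apply: rect13 Ta01 T001 (rect23 Tab1 Ta01 Tabz).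
have := sel0 (enum 'I_m); rewrite (_ : [ffun=> _] = [ffun=> c0]) ?idem3 //.
by apply/ffunP=> s; rewrite !ffunE mem_enum.
Qed.

End NoCollapse.

(** * From a WNU vector-function to a Maltsev operation *)

Lemma pattern_rectangular {A : finType} {n : nat} {sigma : rel_on A n} {i j} x a a' b b' :
    pattern_rel sigma i j -> i != j ->
    upd (upd x i a) j b \in sigma -> upd (upd x i a') j b \in sigma ->
    upd (upd x i a) j b' \in sigma ->
  upd (upd x i a') j b' \in sigma.
Proof.
move=> pat ij ab a'b ab'; apply: contraT => a'b'N; case: pat.
exists (upd (upd x i a') j b'), a, b; split=> //.
- by rewrite [upd (upd _ j _) i _]updC ?upd_upd // eq_sym.
- by rewrite upd_upd.
- by rewrite [upd (upd _ j _) i _]updC ?upd_upd // eq_sym.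
Qed.

Lemma other_indices {n : nat} (k : 'I_n) : (3 <= n)%N ->
  exists i j, [/\ i != j, i != k & j != k].
Proof.
move=> n3.
have /card_gt0P[i] : (0 < #|predC1 k|)%N.
  by rewrite cardC1 card_ord; case: n n3 {k} => [|[|[|]]].
rewrite inE => ik.
have /card_gt0P[j] : (0 < #|~: [set i; k]|)%N.
  by rewrite cardsCs setCK card_ord cards2 ik; case: n n3 {k i ik} => [|[|[|]]].
by rewrite !inE negb_or eq_sym => /andP[]; exists i, j.
Qed.

Section WNU.
Context {A : finType} {n m : nat} {sigma : rel_on A n}.
Variable f : 'I_n -> {ffun 'I_m -> A} -> A.
Hypotheses (n_ge3 : (3 <= n)%N) (pat : pattern_full sigma) (wnu : WNU_preserves f sigma).

(** The collapse argument applies to [sigma] restricted to [k] and two further coordinates, the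
    others being frozen at [a]; idempotence lets [f] act on this restriction. *)
Lemma wnu_no_collapse (a : tup A n) (k : 'I_n) c (t : 'I_m) :
    a \notin sigma -> (forall i, exists b, upd a i b \in sigma) ->
    upd a k c \in sigma ->
  upd a k (f k [ffun s => if s == t then a k else c]) \notin sigma.
Proof.
move=> aN aupd kc; apply: contra aN => col.
have [wnuf presf] := wnu.
have [i [j [ij ik jk]]] := other_indices k n_ge3.
have [ai iai] := aupd i; have [aj jaj] := aupd j.
pose T x y z := upd (upd (upd a i x) j y) k z \in sigma.
have T0 : upd (upd (upd a i (a i)) j (a j)) k (a k) = a by rewrite !upd_id.
have TE x y z : T x y z = (upd (upd (upd a i x) j y) k z \in sigma) by [].
rewrite -T0 -TE.
have idem l x : f l [ffun=> x] = x by have [_ []] := wnuf l.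
apply: (@collapse_contradiction _ m (f i) (f j) (f k) T _ _ _ _ _ _ _ _ ai _ aj _ c) => //.
- move=> x y z Txyz.
  have /presf := Txyz; rewrite TE.
  set u := [ffun=> _]; set v := upd _ _ _; suff -> : u = v by [].
  apply/ffunP=> l; rewrite !ffunE; case: (l =P k) => [->|/eqP lk].
    by congr (f k); apply/ffunP=> s; rewrite !ffunE eqxx.
  case: (l =P j) => [->|/eqP lj].
    by congr (f j); apply/ffunP=> s; rewrite !ffunE (negPf jk) eqxx.
  case: (l =P i) => [->|/eqP li].
    by congr (f i); apply/ffunP=> s; rewrite !ffunE (negPf ik) (negPf ij) eqxx.
  rewrite -[RHS](idem l); congr (f l); apply/ffunP=> s.
  by rewrite !ffunE (negPf lk) (negPf lj) (negPf li).
- move=> x x' y y' z; rewrite !TE ![upd (upd _ j _) k _]updC // ![upd (upd _ i _) k _]updC //.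
  exact: (pattern_rectangular (pat ij) ij).
- move=> x x' y z z'; rewrite !TE ![upd (upd _ i _) j _]updC //.
  exact: (pattern_rectangular (pat ik) ik).
- move=> x y y' z z'; rewrite !TE.
  exact: (pattern_rectangular (pat jk) jk).
- rewrite TE; suff -> : upd (upd (upd a i ai) j (a j)) k (a k) = upd a i ai by [].
  apply/ffunP=> l; rewrite !updE; case: (l =P k) => [->|_].
    by rewrite eq_sym (negPf ik).
  by case: (l =P j) => [->|//]; rewrite eq_sym (negPf ij).
- by rewrite TE upd_id updC // upd_id.
- by rewrite TE !upd_id.
(* The WNU identity moves the exceptional argument from [t] to any position [s]. *)
- move=> s; rewrite TE !upd_id; have [_ [_ wk]] := wnuf k.
  by rewrite (wk c (a k) s t).
Qed.

Hypothesis key_upd : forall a i, key_tuple sigma a -> exists b, upd a i b \in sigma.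
Hypothesis key_inj : forall a Phi, key_tuple sigma a -> preserves Phi sigma ->
    vapply Phi a \notin sigma -> forall i, {in proj sigma i &, injective (Phi i)}.

(** These are the parameters for which translation by [f] will be shown injective; they include the
    sides of every key block. *)
Definition near_key (i : 'I_n) : {set A} :=
  [set c | [exists a : tup A n, [exists k, [exists b,
     [&& key_tuple sigma a, upd a k b \in sigma & upd a k b i == c]]]]].

Lemma wnu_translation_stable i (t : 'I_m) (c : tup A n) : c \in sigma ->
  {in proj sigma i, forall x, f i [ffun s => if s == t then x else c i] \in proj sigma i}.
Proof.
move=> cs _ /imsetP[z zs ->].
have [_ /(_ (fun s => if s == t then z else c))] := wnu.
set w := [ffun l => _] => ws; have -> : f i [ffun s => if s == t then z i else c i] = w i.
  by rewrite ffunE; congr (f i); apply/ffunP=> s; rewrite !ffunE; case: ifP.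
by apply/mem_proj/ws => s; case: ifP.
Qed.

(** Freezing all arguments of [f] but one at the completion of [a] gives a vector-function
    preserving [sigma]. It keeps [a] outside [sigma] by [wnu_no_collapse], so [key_inj] applies. *)
Lemma wnu_translation_injective i (t : 'I_m) b : b \in near_key i ->
  {in proj sigma i &, injective (fun x => f i [ffun s => if s == t then x else b])}.
Proof.
rewrite inE => /existsP[a /existsP[k /existsP[c /and3P[ka cs /eqP <-]]]].
have [wnuf presf] := wnu.
pose Phi : uvf A n :=
  [ffun l => [ffun x => f l [ffun s => if s == t then x else upd a k c l]]].
have pPhi : preserves Phi sigma.
  apply/preservesP=> z zs.
  have := presf (fun s => if s == t then z else upd a k c).
  have -> // : [ffun l => f l [ffun s => (if s == t then z else upd a k c) l]]
    = vapply Phi z.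
    apply/ffunP=> l; rewrite !ffunE; congr (f l); apply/ffunP=> s.
    by rewrite !ffunE; case: ifP; rewrite ?ffunE.
  by apply=> s; case: ifP.
have PaE : vapply Phi a = upd a k (f k [ffun s => if s == t then a k else c]).
  apply/ffunP=> l; rewrite !ffunE; case: (l =P k) => [->|/eqP lk].
    by congr (f k); apply/ffunP=> s; rewrite !ffunE eqxx.
  have [_ [idem _]] := wnuf l; rewrite -[RHS]idem; congr (f l); apply/ffunP=> s.
  by rewrite !ffunE if_same.
have PaN : vapply Phi a \notin sigma.
  rewrite PaE; apply: wnu_no_collapse => // [|l]; last exact: key_upd.
  by case/key_tupleP: ka.
move=> x y xp yp /= exy; have inj := key_inj ka pPhi PaN (i := i).
by apply: inj => //; rewrite !ffunE; move: exy; rewrite !ffunE.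
Qed.

Lemma wnu_maltsev : exists p : 'I_n -> A -> A -> A -> A,
  (forall x b y : tup A n, x \in sigma -> b \in sigma -> y \in sigma ->
     [ffun i => p i (x i) (b i) (y i)] \in sigma) /\
  (forall i b x, b \in near_key i -> x \in proj sigma i ->
     p i x b b = x /\ p i b b x = x).
Proof.
have [wnuf presf] := wnu.
have m2 : (1 < m)%N by have [] := wnuf (Ordinal (ltnW (ltnW n_ge3))).
pose t0 : 'I_m := Ordinal (ltnW m2); pose t1 : 'I_m := Ordinal m2.
pose L i b x := f i [ffun s => if s == t0 then x else b].
pose N := #|{perm A}|.
have N_gt0 : (0 < N)%N by apply/card_gt0P; exists 1%g.
(* With [L i b] the translation by [b], both [p i x b b] and [p i b b x] are its [N]-th iterate at
   [x], the second by the WNU identity; [N] is chosen so that this iterate is the identity. *)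
exists (fun i x b y => iter N.-1 (L i b)
   (f i [ffun s => if s == t0 then x else if s == t1 then y else b])).
split=> [x b y xs bs ys|i b x bk xp].
  elim: N.-1 => [|k IH] /=.
    have := presf (fun s => if s == t0 then x else if s == t1 then y else b).
    set u := [ffun=> _]; set v := [ffun=> _]; have -> : u = v.
      apply/ffunP=> i; rewrite !ffunE; congr (f i); apply/ffunP=> s.
      by rewrite !ffunE; case: ifP => // _; case: ifP.
    by apply=> s; case: ifP => // _; case: ifP.
  set w := [ffun=> _] in IH.
  have := presf (fun s => if s == t0 then w else b).
  set u := [ffun=> _]; set v := [ffun=> _]; have -> : u = v.
    apply/ffunP=> i; rewrite !ffunE; congr (f i); apply/ffunP=> s.
    by rewrite !ffunE; case: ifP; rewrite ?ffunE.
  by apply=> s; case: ifP.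
have LN : iter N (L i b) x = x.
  apply: iter_card_perm xp; last exact: wnu_translation_injective.
  move: bk; rewrite inE => /existsP[a /existsP[k /existsP[c /and3P[ka cs /eqP <-]]]].
  exact: wnu_translation_stable.
split; rewrite -[RHS]LN -[in RHS](prednK N_gt0) iterSr; congr iter.
  by rewrite /L; congr (f i); apply/ffunP=> s; rewrite !ffunE if_same.
have [_ [_ wi]] := wnuf i; rewrite /L (wi b x t0 t1); congr (f i).
by apply/ffunP=> s; rewrite !ffunE; case: (s =P t0) => [->|].
Qed.

End WNU.

(** * Homogeneous finite abelian groups are additive groups of fields *)

(** Cauchy gives an element of prime order [p], and endomorphisms send it to every nonzero element,
    so the group is elementary abelian. It is then isomorphic to the additive group of the field of
    the same order. *)
Lemma zmod_homogeneous_field (V : finZmodType) :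
    (exists g : V, g != 0) ->
    (forall g h : V, g != 0 -> h != 0 ->
       exists2 th : V -> V, {morph th : x y / x + y} & th g = h) ->
  exists (F : finFieldType) (phi : V -> F), bijective phi /\ {morph phi : x y / x + y}.
Proof.
move=> [g0 g0N] hom; pose G := [set: V]%G.
have cG : (1 < #|G|)%N.
  rewrite cardG_gt1; apply/trivgPn; exists g0 => //; exact: in_setT.
have p_pr := pdiv_prime cG; set p := pdiv #|G| in p_pr.
have [g _ og] := Cauchy p_pr (pdiv_dvd #|G|).
have gN : g != 0.
  by apply: contraTneq (prime_gt1 p_pr) => g0E; rewrite -og g0E order1.
have abG : (p.-abelem G)%g.
  apply/abelemP => //; split=> [|h _]; first exact: FinRing.zmod_abelian.
  have [->|hN] := eqVneq h 0; first by rewrite FinRing.zmodXgE mul0rn.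
  have [th thD <-] := hom g h gN hN.
  have th0 : th 0 = 0 by apply: (addrI (th 0)); rewrite -thD !addr0.
  have thn k : th (g *+ k) = th g *+ k.
    by elim: k => [|k IH]; rewrite ?mulr0n // !mulrS thD IH.
  by rewrite FinRing.zmodXgE -thn -FinRing.zmodXgE -og expg_order th0.
have [[|k] cGk] : {k | #|G| = (p ^ k)%N}.
- by exists (logn p #|G|); apply: card_pgroup (abelem_pgroup abG).
- by rewrite cGk in cG.
have [F charF cF] := pPrimePowerField p_pr (ltn0Sn k).
have /isogP[f injf imf] : (G \isog [set: F])%g.
  by rewrite (isog_abelem_card _ abG) fin_ring_pchar_abelem //= cardsT cF -cGk.
exists F, f; split; last by move=> x y; apply: morphM; apply: in_setT.
apply: inj_card_bij.
  by move=> x y; apply: (injmP injf); apply: in_setT.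
by rewrite cF -cGk cardsT.
Qed.

Lemma set_homogeneous_field {A : finType} (S : {set A}) (add : A -> A -> A) (o : A) :
    {in S &, forall x y, add x y \in S} ->
    {in S & &, forall x y z, add x (add y z) = add (add x y) z} ->
    {in S &, commutative add} -> o \in S -> {in S, left_id o add} ->
    {in S, forall x, exists2 y, y \in S & add y x = o} ->
    (exists2 g, g \in S & g != o) ->
    (forall g h, g \in S -> h \in S -> g != o -> h != o ->
       exists th : A -> A, [/\ {in S, forall x, th x \in S},
         {in S &, {morph th : x y / add x y}} & th g = h]) ->
  exists (F : finFieldType) (phi : A -> F),
    [/\ {in S &, injective phi}, forall y, exists2 a, a \in S & phi a = y
      & {in S &, forall x y, phi (add x y) = phi x + phi y}].
Proof.
move=> addS addA addC oS add0 addN [g gS gN] hom.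
pose T := {x : A | x \in S}.
pose mk x (xS : x \in S) : T := exist (fun x => x \in S) x xS.
pose zT : T := mk o oS.
pose aT (u v : T) : T := mk _ (addS _ _ (valP u) (valP v)).
have aTA : associative aT by move=> u v w; apply/val_inj/addA; apply: valP.
have aTC : commutative aT by move=> u v; apply/val_inj/addC; apply: valP.
have aT0 : left_id zT aT by move=> u; apply/val_inj/add0/valP.
have aTN u : exists v, aT v u == zT.
  have [y yS yu] := addN _ (valP u).
  by exists (mk y yS); apply/eqP/val_inj.
pose oT u := xchoose (aTN u).
have oTP : left_inverse zT oT aT by move=> u; apply/eqP; apply: (xchooseP (aTN u)).
pose V : finZmodType := HB.pack T (GRing.isZmodule.Build T aTA aTC aT0 oTP).
have [||F [phi [[psi phiK psiK] phiD]]] := @zmod_homogeneous_field V.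
- by exists (mk g gS : V); apply: contra gN => /eqP/(congr1 val)/= ->.
- move=> u v uN vN.
  have [||th [thS thD thu]] := hom (val (u : T)) (val (v : T)) (valP (u : T)) (valP (v : T)).
  + by apply: contra uN => /eqP e; apply/eqP/val_inj.
  + by apply: contra vN => /eqP e; apply/eqP/val_inj.
  exists (fun w : T => mk _ (thS _ (valP w))); last exact: val_inj.
  by move=> w w'; apply/val_inj/thD; apply: valP.
(* The default [zT] only gives [phi] a value outside [S]. *)
exists F, (fun x => phi (insubd (zT : T) x : T)); split=> [x y xS yS|y|x y xS yS].
- by move/(can_inj phiK)/(congr1 val); rewrite !insubdK.
- exists (val (psi y : T)); first exact: valP.
  by rewrite valKd psiK.
- rewrite -phiD; congr phi; apply: val_inj.
  by rewrite /= !insubdK // addS.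
Qed.

(** * Key blocks that are boxes *)

Section KeyBlock.
Context {A : finType} {n : nat} {sigma : rel_on A n}.
Variable Ai : 'I_n -> {set A}.
Implicit Types x y z : tup A n.

Definition box : rel_on A n := [set x : tup A n | [forall i, x i \in Ai i]].

Lemma boxP {x} : reflect (forall i, x i \in Ai i) (x \in box).
Proof. by rewrite inE; apply: forallP. Qed.

Lemma box_upd x i b : x \in box -> b \in Ai i -> upd x i b \in box.
Proof.
by move=> /boxP xb bA; apply/boxP=> k; rewrite updE; case: eqP => // ->.
Qed.

Hypothesis kb : key_block sigma box.

Lemma key_edge_sym : symmetric (key_edge sigma).
Proof.
move=> x y; rewrite /key_edge /adjacent andbCA; do 2!congr andb.
by congr (_ == _); apply: eq_card => i; rewrite !inE eq_sym.
Qed.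

Lemma key_block_Key x : x \in box -> x \in Key sigma.
Proof.
have [b kb' ->] := kb; rewrite inE => /connectP[s].
elim/last_ind: s => [_ ->|s y _]; first by rewrite !inE kb' orbT.
by rewrite rcons_path last_rcons => /andP[_ /and3P[_ yK _]] ->.
Qed.

Lemma key_blockP x : x \in box -> x \notin sigma -> key_tuple sigma x.
Proof. by move=> /key_block_Key; rewrite !inE => /orP[->|]. Qed.

Lemma key_block_connect x y : x \in box ->
  (y \in box) = connect (key_edge sigma) x y.
Proof.
have [b _ ->] := kb; rewrite !inE => bx.
exact: (same_connect (sym_connect_sym key_edge_sym) bx).
Qed.

Lemma key_block_upd x i b : x \in box -> upd x i b \in sigma -> b \in Ai i.
Proof.
move=> xb us; have [->|bN] := eqVneq b (x i); first exact: (boxP xb).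
suff /boxP/(_ i) : upd x i b \in box by rewrite updE eqxx.
rewrite (key_block_connect _ xb) connect1 // /key_edge key_block_Key //= inE us /=.
rewrite /adjacent (_ : [set k | _] = [set i]) ?cards1 //.
apply/setP=> k; rewrite !inE updE; case: (k =P i) => [->|]; last by rewrite eqxx.
by rewrite eq_sym.
Qed.

(** [Phi] maps [Key sigma] to itself and sends adjacent tuples to equal or adjacent ones, so it
    sends a connected component into a single one. *)
Lemma key_block_endo Phi x y : preserves Phi sigma ->
  x \in box -> vapply Phi x \in box -> y \in box -> vapply Phi y \in box.
Proof.
move=> pPhi xb Pxb; rewrite (key_block_connect _ xb) (key_block_connect _ Pxb).
have PhiK z : z \in Key sigma -> vapply Phi z \in Key sigma.
  rewrite !inE => /orP[zs|kz]; first by rewrite (preservesP pPhi).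
  by have [//|/(key_tuple_image kz pPhi)->] := boolP (vapply Phi z \in sigma); rewrite orbT.
case/connectP=> s; elim: s x {xb Pxb} => [|z s IH] x /=; first by move=> _ ->.
case/andP=> /and3P[xK zK /eqP adj] zs ly; apply: connect_trans (IH z zs ly).
have [->|neq] := eqVneq (vapply Phi x) (vapply Phi z); first exact: connect0.
apply: connect1; rewrite /key_edge !PhiK //= /adjacent eqn_leq -{1}adj.
rewrite subset_leq_card /=; last first.
  by apply/subsetP=> i; rewrite !inE !ffunE; apply: contra => /eqP->.
apply/card_gt0P; have [i Pi] : exists i, vapply Phi x i != vapply Phi z i.
  by apply/existsP; apply: contraR neq => /existsPn H; apply/eqP/ffunP=> i; apply/eqP/negPn.
by exists i; rewrite inE.
Qed.

Lemma key_block_has_key : exists2 a, a \in box & key_tuple sigma a.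
Proof. by have [b kb' ->] := kb; exists b => //; rewrite inE connect0. Qed.

Hypothesis key_upd : forall a i, key_tuple sigma a -> exists b, upd a i b \in sigma.
Hypothesis key_inj : forall a Phi, key_tuple sigma a -> preserves Phi sigma ->
    vapply Phi a \notin sigma -> forall i, {in proj sigma i &, injective (Phi i)}.

Lemma key_block_rich x i : x \in box -> exists2 b, b \in Ai i & upd x i b \in sigma.
Proof.
move=> xb; suff [b bs] : exists b, upd x i b \in sigma.
  by exists b => //; apply: key_block_upd bs.
have [xs|/(key_blockP xb)/(key_upd i)//] := boolP (x \in sigma).
by exists (x i); rewrite upd_id.
Qed.

Lemma near_key_proj i b : b \in near_key (sigma := sigma) i -> b \in proj sigma i.
Proof.
rewrite inE => /existsP[a /existsP[k /existsP[c /and3P[_ cs /eqP <-]]]].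
exact: mem_proj.
Qed.

Hypothesis n_gt1 : (1 < n)%N.

(** If placing [b] at [i] in a key tuple does not give a tuple of [sigma], it gives another key
    tuple, whose completion at some other coordinate still has [b] at [i]. *)
Lemma key_block_near_key i b : b \in Ai i -> b \in near_key (sigma := sigma) i.
Proof.
have [a ab ka] := key_block_has_key => bA.
rewrite inE; have [us|uN] := boolP (upd a i b \in sigma).
  apply/existsP; exists a; apply/existsP; exists i; apply/existsP; exists b.
  by rewrite ka us updE !eqxx.
have ku := key_blockP (box_upd ab bA) uN.
have [j ji] := other_index n_gt1 i; have [c cs] := key_upd j ku.
apply/existsP; exists (upd a i b); apply/existsP; exists j; apply/existsP; exists c.
by rewrite ku cs !updE (eq_sym i j) (negPf ji) !eqxx.
Qed.

Variable p : 'I_n -> A -> A -> A -> A.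
Hypothesis presp : forall x b y : tup A n, x \in sigma -> b \in sigma -> y \in sigma ->
  [ffun i => p i (x i) (b i) (y i)] \in sigma.
Hypothesis maltsev : forall i b (x : A), b \in near_key (sigma := sigma) i ->
  x \in proj sigma i -> p i x b b = x /\ p i b b x = x.

(* If two values [b] and [c] could both complete [x] at [i], the Maltsev operation
   would make them interchangeable in [sigma], and merging them would be a
   non-injective vector-function fixing a key tuple. *)
Lemma key_block_uniq x i b c : x \in box ->
  upd x i b \in sigma -> upd x i c \in sigma -> b = c.
Proof.
move=> xb bs cs; apply: contraTeq isT => bNc.
have bA := key_block_upd xb bs; have cA := key_block_upd xb cs.
have [a ab ka] := key_block_has_key.
(* Exchanging [b] and [c] if necessary ensures that merging [b] into [c] fixes [a]. *)
wlog aNb : b c bs cs bNc bA cA / a i != b.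
  move=> IH; have [aib|aiNb] := eqVneq (a i) b; last exact: (IH b c).
  by apply: (IH c b) => //; rewrite ?aib // eq_sym.
pose Phi : uvf A n := [ffun k => [ffun d => if (k == i) && (d == b) then c else d]].
have pPhi : preserves Phi sigma.
  apply/preservesP=> z zs; have [zib|ziNb] := eqVneq (z i) b; last first.
    rewrite (_ : vapply Phi z = z) //; apply/ffunP=> k; rewrite !ffunE.
    by case: (k =P i) => //= ->; rewrite (negPf ziNb).
  (* Off [i] the last two arguments of [p] coincide and return [z]; at [i] the value is [p i b b c],
     which is [c]. *)
  have := presp zs bs cs; rewrite (_ : [ffun=> _] = vapply Phi z) //.
  apply/ffunP=> k; rewrite !ffunE; case: (k =P i) => [->|_] /=.
    rewrite zib eqxx.
    by case: (maltsev (key_block_near_key bA) (near_key_proj (key_block_near_key cA))).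
  by case: (maltsev (key_block_near_key (boxP xb k)) (mem_proj k zs)).
have Pa : vapply Phi a = a.
  apply/ffunP=> k; rewrite !ffunE.
  by case: (k =P i) => //= ->; rewrite (negPf aNb).
have PaN : vapply Phi a \notin sigma by rewrite Pa; case/key_tupleP: ka.
have inj := key_inj ka pPhi PaN (i := i).
suff bc : b = c by rewrite bc eqxx in bNc.
apply: inj; try exact/near_key_proj/key_block_near_key.
by rewrite !ffunE !eqxx /=; case: ifP.
Qed.

End KeyBlock.

Arguments boxP {A n Ai x}.

(** * The group law on a block and the linear equation *)

Section LatinBox.
Context {A : finType} {n : nat} {sigma : rel_on A n}.
Variables (Ai : 'I_n -> {set A}) (p : 'I_n -> A -> A -> A -> A) (o : tup A n).
Implicit Types s t : tup A n.
Hypothesis n_ge3 : (3 <= n)%N.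
Hypothesis rich : forall s i, s \in box Ai -> exists2 b, b \in Ai i & upd s i b \in sigma.
Hypothesis closed : forall s i b, s \in box Ai -> upd s i b \in sigma -> b \in Ai i.
Hypothesis completion_uniq : forall s i b c, s \in box Ai ->
  upd s i b \in sigma -> upd s i c \in sigma -> b = c.
Hypothesis presp : forall s b t, s \in sigma -> b \in sigma -> t \in sigma ->
  [ffun i => p i (s i) (b i) (t i)] \in sigma.
Hypothesis maltsev : forall i b x, b \in Ai i -> x \in Ai i ->
  p i x b b = x /\ p i b b x = x.
Hypotheses (os : o \in sigma) (ob : o \in box Ai).

Definition boxadd i x y := p i x (o i) y.
Definition tupadd s t : tup A n := [ffun i => boxadd i (s i) (t i)].

Let oA i : o i \in Ai i. Proof. exact: (boxP ob). Qed.

Lemma tupadd_sigma s t : s \in sigma -> t \in sigma -> tupadd s t \in sigma.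
Proof. by move=> ss ts; apply: presp. Qed.

Lemma boxadd0l i x : x \in Ai i -> boxadd i (o i) x = x.
Proof. by case/(maltsev (oA i)). Qed.

Lemma boxadd0r i x : x \in Ai i -> boxadd i x (o i) = x.
Proof. by case/(maltsev (oA i)). Qed.

Lemma tupadd_same i j x y x' y' : i != j ->
  tupadd (upd (upd o i x) j x') (upd (upd o i y) j y')
  = upd (upd o i (boxadd i x y)) j (boxadd j x' y').
Proof.
move=> ij; apply/ffunP=> l; rewrite !ffunE.
case: (l =P j) => [->|_] //; case: (l =P i) => [->|_] //.
exact: boxadd0l.
Qed.

(** At [j] and at [k] one of the two summands is [o], which is neutral, so the two tuples interfere
    only at [i]. *)
Lemma tupadd_three i j k x y x' y' : i != j -> i != k -> j != k ->
    x' \in Ai j -> y' \in Ai k ->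
    upd (upd o i x) j x' \in sigma -> upd (upd o i y) k y' \in sigma ->
  upd (upd (upd o j x') k y') i (boxadd i x y) \in sigma.
Proof.
move=> ij ik jk x'A y'A xs ys.
suff -> : upd (upd (upd o j x') k y') i (boxadd i x y)
    = tupadd (upd (upd o i x) j x') (upd (upd o i y) k y') by apply: tupadd_sigma.
apply/ffunP=> l; rewrite !ffunE; case: (l =P i) => [->|_].
  by rewrite (negPf ij) (negPf ik).
case: (l =P k) => [->|_]; first by rewrite eq_sym (negPf jk) boxadd0l.
by case: (l =P j) => [->|_]; rewrite ?boxadd0r ?boxadd0l.
Qed.

Lemma boxadd_closed i x y : x \in Ai i -> y \in Ai i -> boxadd i x y \in Ai i.
Proof.
move=> xA yA; have [j [k [jk ji ki]]] := other_indices i n_ge3.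
have [x' x'A xs] := rich j (box_upd ob xA); have [y' y'A ys] := rich k (box_upd ob yA).
apply: (@closed (upd (upd o j x') k y')); first by rewrite !box_upd.
by apply: tupadd_three => //; rewrite eq_sym.
Qed.

(** Both sides complete the same tuple [s] at [i]: the left one by adding two instances of
    [tupadd_three], the right one by adding first within the planes [i, j] and [i, k]. *)
Lemma boxadd_medial i x y u v : x \in Ai i -> y \in Ai i -> u \in Ai i -> v \in Ai i ->
  boxadd i (boxadd i x y) (boxadd i u v) = boxadd i (boxadd i x u) (boxadd i y v).
Proof.
move=> xA yA uA vA; have [j [k [jk ji ki]]] := other_indices i n_ge3.
have ij : i != j by rewrite eq_sym.
have ik : i != k by rewrite eq_sym.
have [x' x'A xs] := rich j (box_upd ob xA); have [y' y'A ys] := rich k (box_upd ob yA).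
have [u' u'A us] := rich j (box_upd ob uA); have [v' v'A vs] := rich k (box_upd ob vA).
pose s := upd (upd o j (boxadd j x' u')) k (boxadd k y' v').
apply: (@completion_uniq s i); first by rewrite !box_upd // boxadd_closed.
  have := tupadd_sigma (tupadd_three ij ik jk x'A y'A xs ys) (tupadd_three ij ik jk u'A v'A us vs).
  suff -> : tupadd (upd (upd (upd o j x') k y') i (boxadd i x y))
      (upd (upd (upd o j u') k v') i (boxadd i u v))
      = upd s i (boxadd i (boxadd i x y) (boxadd i u v)) by [].
  by rewrite /s -tupadd_same //; apply/ffunP=> l; rewrite !ffunE; case: (l =P i) => [->|].
apply: tupadd_three => //; try exact: boxadd_closed.
  by rewrite -tupadd_same // tupadd_sigma.
by rewrite -tupadd_same // tupadd_sigma.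
Qed.

(* Eckmann-Hilton: a medial operation with a unit is associative and commutative. *)
Lemma boxaddC i : {in Ai i &, commutative (boxadd i)}.
Proof.
move=> x y xA yA.
by rewrite -{1}[x](boxadd0l xA) -{1}[y](boxadd0r yA) boxadd_medial // (boxadd0l yA) (boxadd0r xA).
Qed.

Lemma boxaddA i : {in Ai i & &, forall x y z, boxadd i x (boxadd i y z) = boxadd i (boxadd i x y) z}.
Proof.
move=> x y z xA yA zA.
by rewrite -{1}[x](boxadd0r xA) boxadd_medial // (boxadd0l zA).
Qed.

Lemma boxaddN i : {in Ai i, forall x, exists2 y, y \in Ai i & boxadd i y x = o i}.
Proof.
move=> x xA; have [j [k [jk ji ki]]] := other_indices i n_ge3.
have ij : i != j by rewrite eq_sym.
have ik : i != k by rewrite eq_sym.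
(* Going from [x] at [i] to [j], on to [k] and back to [i] takes three completions, each a negation,
   and so ends at the inverse of [x]. *)
have [x' x'A xs] := rich j (box_upd ob xA).
have [y' y'A ys] := rich k (box_upd ob x'A).
have [y yA zs] := rich i (box_upd ob y'A).
exists y => //; rewrite boxaddC //; apply: (@completion_uniq (upd (upd o j x') k y') i).
- by rewrite !box_upd.
- by apply: tupadd_three => //; rewrite updC.
- rewrite (_ : upd _ i _ = upd (upd o j x') k y') //.
  rewrite -[RHS](upd_id _ i); congr upd.
  by rewrite !updE (negPf ij) (negPf ik).
Qed.

Variable i0 : 'I_n.
Hypothesis nontrivial : exists2 a, a \in box Ai & a \notin sigma.
Hypothesis homogeneous : forall g h, g \in Ai i0 -> h \in Ai i0 -> g != o i0 -> h != o i0 ->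
  exists Phi : uvf A n, [/\ preserves Phi sigma, vapply Phi (upd o i0 g) = upd o i0 h
    & {in box Ai, forall s, vapply Phi s \in box Ai}].

(** [Phi] fixes [o]: the image agrees with [o] off [i0] and lies in [sigma], so uniqueness settles
    [i0]. The image of a sum and the sum of the images then complete the same tuple. *)
Lemma endo_additive g h : g \in Ai i0 -> h \in Ai i0 -> g != o i0 -> h != o i0 ->
  exists th : A -> A, [/\ {in Ai i0, forall x, th x \in Ai i0},
     {in Ai i0 &, {morph th : x y / boxadd i0 x y}} & th g = h].
Proof.
move=> gA hA gN hN; have [Phi [/preservesP pPhi Phig Phib]] := homogeneous gA hA gN hN.
have PhioN l : l != i0 -> Phi l (o l) = o l.
  by move=> li; have /ffunP/(_ l) := Phig; rewrite !ffunE (negPf li).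
have Phig0 : Phi i0 g = h by have /ffunP/(_ i0) := Phig; rewrite !ffunE eqxx.
have Phio : vapply Phi o = o.
  have e : vapply Phi o = upd o i0 (Phi i0 (o i0)).
    by apply/ffunP=> l; rewrite !ffunE; case: (l =P i0) => [->|/eqP/PhioN].
  have := pPhi _ os; rewrite e => es; rewrite -[RHS](upd_id o i0); congr upd.
  by apply: (@completion_uniq o i0) => //; rewrite upd_id.
have PhiA l x : x \in Ai l -> Phi l x \in Ai l.
  by move=> xA; have /boxP/(_ l) := Phib _ (box_upd ob xA); rewrite vapply_upd updE eqxx.
exists (Phi i0); split=> // [x|x y xA yA]; first exact: PhiA.
have [j [k [jk ji ki]]] := other_indices i0 n_ge3.
have ij : i0 != j by rewrite eq_sym.
have ik : i0 != k by rewrite eq_sym.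
have [x' x'A xs] := rich j (box_upd ob xA); have [y' y'A ys] := rich k (box_upd ob yA).
apply: (@completion_uniq (upd (upd o j (Phi j x')) k (Phi k y')) i0).
- by rewrite !box_upd // PhiA.
- have := pPhi _ (tupadd_three ij ik jk x'A y'A xs ys).
  by rewrite !vapply_upd Phio.
- apply: tupadd_three => //; try exact: PhiA.
    by have := pPhi _ xs; rewrite !vapply_upd Phio.
  by have := pPhi _ ys; rewrite !vapply_upd Phio.
Qed.

(** For [i] other than [i0], this transports [A_i] to [A_{i0}] with a change of sign. The default
    [x] is never taken on [Ai i]. *)
Definition partner i x := odflt x [pick y in Ai i0 | upd (upd o i x) i0 y \in sigma].

Lemma partnerP i x : x \in Ai i ->
  partner i x \in Ai i0 /\ upd (upd o i x) i0 (partner i x) \in sigma.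
Proof.
move=> xA; rewrite /partner; case: pickP => [y /andP[]//|none].
have [y yA ys] := rich i0 (box_upd ob xA).
by have := none y; rewrite /= yA ys.
Qed.

Lemma latin_box_field : exists (F : finFieldType) (phi : 'I_n -> A -> F),
  (forall i, {in Ai i &, injective (phi i)}) /\
  (forall i (y : F), exists2 a, a \in Ai i & phi i a = y) /\
  (forall x : tup A n, x \in box Ai -> (x \in sigma) = (\sum_(i < n) phi i (x i) == 0)).
Proof.
have [||||||||F [psi [psi_inj psi_surj psiD]]] :=
  @set_homogeneous_field A (Ai i0) (boxadd i0) (o i0).
- exact: boxadd_closed.
- exact: boxaddA.
- exact: boxaddC.
- exact: oA.
- exact: boxadd0l.
- exact: boxaddN.
(* A tuple outside [sigma] and its completion have distinct values at [i0], so one of them differs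
   from [o i0]. *)
- have [a ab aN] := nontrivial; have [b bA bs] := rich i0 ab.
  have [e|bN] := eqVneq b (o i0); last by exists b.
  exists (a i0); first exact: (boxP ab).
  by rewrite -e; apply: contraNneq aN => aib; rewrite -(upd_id a i0) aib.
- exact: endo_additive.
exists F, (fun i x => if i == i0 then psi x else - psi (partner i x)); split; [|split].
- move=> i x y xA yA; case: eqP => [ei|/eqP ii0].
    by apply: psi_inj; rewrite -ei.
  have [cxA cxs] := partnerP xA; have [cyA cys] := partnerP yA.
  move/oppr_inj/(psi_inj _ _ cxA cyA) => ec.
  apply: (@completion_uniq (upd o i0 (partner i x)) i); first exact: box_upd.
    by rewrite updC // eq_sym.
  by rewrite ec updC // eq_sym.
- move=> i y; case: eqP => [ei|/eqP ii0].
    by have [a aA ay] := psi_surj y; exists a; rewrite ?ei.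
  have [c cA cy] := psi_surj (- y).
  have [x xA xs] := rich i (box_upd ob cA); exists x => //.
  have [cxA cxs] := partnerP xA.
  rewrite (_ : partner i x = c) ?cy ?opprK //.
  by apply: (@completion_uniq (upd o i x) i0); rewrite ?box_upd // updC.
- move=> x xb; have xA := boxP xb.
  (* Adding one coordinate of [x] at a time to [o] shows that the partners sum to the completing
     value at [i0]. With [r] everything but [i0], this gives the unique completion of [x]. *)
  have partial (r : seq 'I_n) : seq.uniq r -> i0 \notin r ->
      exists2 c, c \in Ai i0 & psi c = \sum_(i <- r) psi (partner i (x i)) /\
        [ffun l => if l == i0 then c else if l \in r then x l else o l] \in sigma.
    elim: r => [|i r IH] /=.
      move=> _ _; exists (o i0) => //; rewrite big_nil; split.
        by apply: (addrI (psi (o i0))); rewrite -psiD // boxadd0l // addr0.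
      suff -> : [ffun l => if l == i0 then o i0 else if l \in [::] then x l else o l] = o by [].
      by apply/ffunP=> l; rewrite ffunE; case: eqP => // ->.
    case/andP=> iNr ur; rewrite inE negb_or => /andP[i0i i0r].
    have [c cA [cE cs]] := IH ur i0r; have [chA chs] := partnerP (xA i).
    exists (boxadd i0 (partner i (x i)) c); first exact: boxadd_closed.
    rewrite psiD // big_cons cE; split=> //.
    have := tupadd_sigma chs cs; set u := tupadd _ _; set v := [ffun l => _].
    suff -> : u = v by [].
    apply/ffunP=> l; rewrite !ffunE inE; case: (l =P i0) => [->//|_].
    case: (l =P i) => [->|_] /=; first by rewrite (negPf iNr) boxadd0r.
    by rewrite boxadd0l //; case: ifP.
  have [||c cA [cE cs]] := partial (rem i0 (enum 'I_n)).
  + exact/rem_uniq/enum_uniq.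
  + by rewrite mem_rem_uniq ?enum_uniq // inE eqxx.
  have xcs : upd x i0 c \in sigma.
    suff -> : upd x i0 c
      = [ffun l => if l == i0 then c else if l \in rem i0 (enum 'I_n) then x l else o l] by [].
    apply/ffunP=> l; rewrite !ffunE mem_rem_uniq ?enum_uniq // inE mem_enum andbT /=.
    by case: eqP.
  have -> : \sum_(i < n) (if i == i0 then psi (x i) else - psi (partner i (x i))) = psi (x i0) - psi c.
    rewrite (bigD1 i0) //= eqxx cE; congr (_ + _).
    rewrite -sumrN rem_filter ?enum_uniq // big_filter big_enum_cond /=.
    by apply: eq_big => [i|i /negPf->].
  rewrite subr_eq0; apply/idP/eqP => [xs|/(psi_inj _ _ (xA i0) cA) xc].
    by congr psi; apply: (@completion_uniq x i0); rewrite ?upd_id.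
  by rewrite -(upd_id x i0) xc.
Qed.

End LatinBox.

(** * Assembly *)

Theorem mainTheorem13 (A : finType) (n : nat) (sigma : {set {ffun 'I_n -> A}})
  (Ai : 'I_n -> {set A}) :
  (3 <= n)%N ->
  (exists rho : {set {ffun 'I_n -> A}},
      [/\ essential rho, key_relation rho & is_core_of rho sigma]) ->
  pattern_full sigma ->
  (exists (m : nat) (f : 'I_n -> {ffun 'I_m -> A} -> A), WNU_preserves f sigma) ->
  key_block sigma [set x : {ffun 'I_n -> A} | [forall i, x i \in Ai i]] ->
  exists (F : finFieldType) (phi : 'I_n -> A -> F),
    (forall i, {in Ai i &, injective (phi i)}) /\
    (forall i (y : F), exists2 a, a \in Ai i & phi i a = y) /\
    (forall x : {ffun 'I_n -> A},
        (x \in sigma /\ (forall i, x i \in Ai i)) <->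
        ((forall i, x i \in Ai i) /\ \sum_(i < n) phi i (x i) = 0)).
Proof.
move=> n_ge3 [rho [ess _ core]] pat [m [f wnu]] kb.
have n_gt1 : (1 < n)%N := ltnW n_ge3.
have key_upd a i := core_key_upd n_gt1 ess core (a := a) i.
have key_inj a Phi := core_injective n_gt1 ess core (a := a) (Phi := Phi).
have [p [presp maltsev]] := wnu_maltsev n_ge3 pat wnu key_upd key_inj.
have rich := key_block_rich kb key_upd.
have near := key_block_near_key kb key_upd n_gt1.
have uniq := key_block_uniq kb key_upd key_inj n_gt1 presp maltsev.
pose i0 : 'I_n := Ordinal (ltnW n_gt1).
have [a ab ka] := key_block_has_key kb.
(* The origin [o] is a completion in [sigma] of a key tuple of the block. *)
have [b bA os] := rich a i0 ab; set o := upd a i0 b in os.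
have ob : o \in box Ai by apply: box_upd.
have keyN g : g \in Ai i0 -> g != o i0 -> key_tuple sigma (upd o i0 g).
  move=> gA gN; apply: (key_blockP kb); first exact: box_upd.
  by apply: contra gN => gs; apply/eqP; apply: (uniq o i0); rewrite ?upd_id.
have [||||F [phi [phi_inj [phi_surj phiE]]]] :=
  @latin_box_field A n sigma Ai p o n_ge3 rich _ uniq presp _ os ob i0.
- by move=> s i c sb; apply: (key_block_upd kb).
- by move=> i c x cA xA; apply: maltsev; [|apply: near_key_proj]; apply: near.
- by exists a => //; case/key_tupleP: ka.
(* Both modified origins are key tuples, so some [Phi] sends one to the other; it keeps the block
   because it keeps one of its tuples there. *)
- move=> g h gA hA gN hN.
  have [hNs /(_ (upd o i0 g))[|Phi pPhi Phig]] := key_tupleP (keyN h hA hN).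
    by case/key_tupleP: (keyN g gA gN).
  exists Phi; split=> // s; apply: (key_block_endo kb pPhi (x := upd o i0 g)).
    exact: box_upd.
  by rewrite Phig box_upd.
exists F, phi; split=> //; split=> // x; split=> [[xs xA]|[xA /eqP sx]]; split=> //.
  by apply/eqP; rewrite -phiE //; apply/boxP.
by rewrite phiE //; apply/boxP.
Qed.
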